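(* Let $\underline{s}=s_1s_2s_3\dots\in\mathbb{Z}^{\mathbb{N}}$ be an external address with preperiod $\ell\ge1$, period $k\ge1$ and $s_1=0$. Then there exist a degree $D\ge2$, an integer $j\in\{0,1,\dots,D-1\}$ and angles $\theta_d\in\mathbb{Q}/\mathbb{Z}$ for $d\ge D$ such that (1) $\theta_{d+1}=Z_j^{(d)}(\theta_d)$ for all $d\ge D$; (2) the spiders $S_d(\theta_d)$ and $\Gamma_{\underline{s}}$ are isomorphic for all $d\ge D$.
   Context: The left shift on $\mathbb{Z}^{\mathbb{N}}$ is $\sigma$; $\underline{s}$ has preperiod $\ell$ and period $k$ if these are its exact preperiod and period under $\sigma$. $<$ on $\mathbb{Z}^{\mathbb{N}}$ is the lexicographic order. The linear order on $\mathbb{R}/\mathbb{Z}$ is induced from $[0,1)$, and angles are represented in $[0,1)$. The maps $Z_j^{(d)}$ (for $d\ge2$, $0\le j\le d-1$): for $\theta\in\mathbb{Q}/\mathbb{Z}$ let $\theta_n=d^{n-1}\theta$ and $\mathscr{O}_d(\theta)=\{\theta_n:n\ge1\}$. For $t\in\mathbb{R}/\mathbb{Z}$, $t\ne\frac{\theta+j}{d}$, let $u_{j,\theta}(t)=m$ if $t\in[\frac md,\frac{m+1}d)$ with $m<j$; $u_{j,\theta}(t)=m+1$ if $t\in[\frac md,\frac{m+1}d)$ with $m>j$; $u_{j,\theta}(t)=j$ if $t\in[\frac jd,\frac{\theta+j}d)$; $u_{j,\theta}(t)=j+1$ if $t\in(\frac{\theta+j}d,\frac{j+1}d)$. If $\frac{\theta+j}d\in\mathscr{O}_d(\theta)$,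 let $u_{j,\theta}(\frac{\theta+j}d)=j$ if $\theta$ is the smaller angle of a companion pair and $j+1$ otherwise. Then $Z_j^{(d)}(\theta)=\sum_{n\ge1}\frac{u_{j,\theta}(\theta_n)}{(d+1)^n}$. Here a companion pair is a pair of distinct angles, of the same exact period $k'\ge2$ under multiplication by $d$, whose parameter rays in the parameter plane of $z^d+c$ land at the same point (the root of a hyperbolic component of the degree-$d$ Multibrot set of period $k'$). Spiders: for $\theta\in\mathbb{Q}/\mathbb{Z}$ strictly preperiodic under multiplication by $d$, $S_d(\theta)=\bigcup_{j\ge1}\{re^{2\pi i d^{j-1}\theta}: r\in[1,\infty]\}$; if $\theta$ is periodic of period $k'$, add $\{re^{2\pi i d^{k'-1}\theta}:r\in[0,1]\}$. Its legs are the connected components of $S_d(\theta)\setminus\{\infty\}$, one for each angle in $\mathscr{O}_d(\theta)$. Exponential spider $\Gamma_{\underline{s}}$: a graph with a vertex $\tilde e_\infty$ at $+\infty$, vertex $\tilde e_1=0$, and, for $2\le n\le\ell+k$, a vertex $\tilde e_n$ on the imaginary axis with $(2s_n-1)\pi<\operatorname{Im}\tilde e_n<(2s_n+1)\pi$, placed so that $\operatorname{Im}\tilde e_n<\operatorname{Im}\tilde e_m$ whenever $\sigma^{\circ(n-1)}(\underline{s})<\sigma^{\circ(m-1)}(\underline{s})$; its legs $\gamma_n$ ($1\le n\le\ell+k$) are the horizontal rays $\{x\ge0,\ y=\operatorname{Im}\tilde e_n\}$ from $\tilde e_n$ to $\tilde e_\infty$. $S_d(\theta)$ and $\Gamma_{\underline{s}}$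 are isomorphic if they have the same number $\ell+k$ of legs and the same circular order of legs, i.e. if $(\theta_{n_1},\dots,\theta_{n_{\ell+k}})$ are the elements of $\mathscr{O}_d(\theta)$ in counterclockwise order, then, up to a cyclic rotation of the indices, $\sigma^{\circ(n_1-1)}(\underline{s})<\sigma^{\circ(n_2-1)}(\underline{s})<\dots<\sigma^{\circ(n_{\ell+k}-1)}(\underline{s})$. *)

(* Defs.v *)
From HB Require Import structures.
From mathcomp Require Import all_boot all_order all_algebra.
From mathcomp Require Import all_classical all_reals all_analysis.
From mathcomp Require Import complex.
Set Implicit Arguments.
Unset Strict Implicit.
Unset Printing Implicit Defensive.
Import Order.TTheory GRing.Theory Num.Theory.
Import numFieldNormedType.Exports.
Local Open Scope classical_set_scope.
Local Open Scope card_scope.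
Local Open Scope ring_scope.

Definition exact_period (T : Type) (f : T -> T) (x : T) (k : nat) : Prop :=
  [/\ (0 < k)%N, iter k f x = x &
      forall k', (0 < k' < k)%N -> iter k' f x <> x].

Definition exact_preperiod_period (T : Type) (f : T -> T) (x : T)
    (l k : nat) : Prop :=
  exact_period f (iter l f x) k /\
  (forall l', (l' < l)%N -> forall k', (0 < k')%N ->
     iter k' f (iter l' f x) <> iter l' f x).

(* External addresses are 0-indexed: the entry s_n of the literature is
   [s n.-1], so s_1 is [s 0%N]. *)
Definition left_shift (s : nat -> int) : nat -> int := fun n => s n.+1.

Definition lexlt (s t : nat -> int) : bool :=
  `[< exists n, (forall m, (m < n)%N -> s m = t m) /\ s n < t n >].

(* Elements of Q/Z and R/Z are represented by their representatives
   in [0, 1). *)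
Definition is_angle (t : rat) : Prop := 0 <= t < 1.

Definition mod1 (F : archiRealFieldType) (x : F) : F := x - (Num.floor x)%:~R.

Definition mul_angle (d : nat) (t : rat) : rat := mod1 (d%:R * t).

(* [angle_iter d theta n] is theta_{n+1} = d^n theta. *)
Definition angle_iter (d : nat) (theta : rat) (n : nat) : rat :=
  iter n (mul_angle d) theta.

Definition angle_orbit (d : nat) (theta : rat) : set rat :=
  range (angle_iter d theta).

Section ParameterRays.
Variable R : realType.

Definition multibrot (d : nat) : set R[i] :=
  [set c | exists M : R[i], forall n : nat,
     `|iter n (fun z : R[i] => z ^+ d + c) 0| <= M].

(* [Psi] restricts to the conformal isomorphism from the exterior of the
   closed unit disk onto the complement of the Multibrot set that is tangent
   to the identity at infinity; these conditions determine it there.  It is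
   the inverse of c |-> phi_c(c), with phi_c the Boettcher coordinate of
   z^d + c at infinity. *)
Definition exterior_map (d : nat) (Psi : R[i] -> R[i]) : Prop :=
  [/\ forall w : R[i], 1 < `|w| -> @derivable R[i] R[i]^o R[i]^o Psi w 1,
      {in [set w : R[i] | 1 < `|w|] &, injective Psi},
      Psi @` [set w : R[i] | 1 < `|w|] = ~` multibrot d &
      Psi w^-1 * w @[w --> (0 : R[i]^o)^'] --> (1 : R[i]^o)].

Definition unit_circle (t : R) : R[i] :=
  (cos (2 * pi * t) +i* sin (2 * pi * t))%C.

Definition parameter_rays_land_together (d : nat) (t t' : R) : Prop :=
  exists Psi, exterior_map d Psi /\ exists c : R[i]^o,
    (Psi (r%:C%C * unit_circle t) @[r --> (1 : R)^'+] --> c) /\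
    (Psi (r%:C%C * unit_circle t') @[r --> (1 : R)^'+] --> c).

(* The common landing point is then automatically the root of a hyperbolic
   component of period [k]: only one parameter ray of period [k] lands at a
   co-root. *)
Definition companion_pair (d : nat) (theta theta' : rat) : Prop :=
  [/\ is_angle theta, is_angle theta', theta <> theta',
      exists k, [/\ (2 <= k)%N, exact_period (mul_angle d) theta k &
                    exact_period (mul_angle d) theta' k] &
      parameter_rays_land_together d (ratr theta) (ratr theta')].

Definition smaller_companion (d : nat) (theta : rat) : Prop :=
  exists theta', companion_pair d theta theta' /\ theta < theta'.

(* For t in [0, 1), [m] is the integer with m/d <= t < (m+1)/d.  The value at
   t = (theta + j)/d is only meaningful when this angle lies in the orbit of
   theta. *)
Definition u_digit (d j : nat) (theta t : rat) : nat :=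
  let c := (theta + j%:R) / d%:R in
  let m := Num.truncn (d%:R * t) in
  if t == c then (if `[< smaller_companion d theta >] then j else j.+1)
  else if (m < j)%N then m
  else if (j < m)%N then m.+1
  else if t < c then j else j.+1.

Definition Zmap (d j : nat) (theta : rat) : R :=
  mod1 (limn (series (fun n : nat =>
    (u_digit d j theta (angle_iter d theta n))%:R / d.+1%:R ^+ n.+1 : R))).

End ParameterRays.

(* The angles [ts] are listed in counterclockwise order around the circle. *)
Definition counterclockwise (ts : seq rat) : Prop :=
  exists r, sorted (fun x y : rat => x < y) (rot r ts).

(* The legs of S_d(theta) correspond to the points of the orbit of theta, and
   those of Gamma_s to the indices n < l + k, ordered vertically as the shifts
   of [s] are lexicographically; here l and k are the preperiod and the period
   of [s]. *)
Definition spiders_isomorphic (d : nat) (theta : rat) (s : nat -> int)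
    (l k : nat) : Prop :=
  angle_orbit d theta #= `I_(l + k) /\
  forall ns : seq nat, perm_eq ns (iota 0 (l + k)) ->
    counterclockwise [seq angle_iter d theta n | n <- ns] ->
    exists r, sorted lexlt [seq iter n left_shift s | n <- rot r ns].

(* Main.v *)
Require Import Defs.
From mathcomp Require Import all_boot all_order all_algebra.
From mathcomp Require Import all_classical all_reals all_analysis.
From mathcomp Require Import ring lra zify.
Set Implicit Arguments.
Unset Strict Implicit.
Unset Printing Implicit Defensive.
Import Order.TTheory GRing.Theory Num.Theory.
Import numFieldNormedType.Exports.
Local Open Scope ring_scope.

(** For a bounded address t, let x_d(t) be the signed base-d expansion
    sum_{i >= 1} t_i / d^i.  If |t_i| <= B for all i and d is large compared
    with B, then |x_d(t)| <= B/(d-1) < 1/2, and x_d is strictly increasing for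
    the lexicographic order, because a difference of at least 1 in the first
    distinct entry outweighs all the later ones.  Set theta_d = x_d(s) mod 1.
    Since d x_d(t) = t_1 + x_d(sigma t), the point d^n theta_d of the orbit is
    x_d(sigma^n s) mod 1.  So the orbit of theta_d is the image of the shift
    orbit of s under an injection into (-1/2, 1/2) that preserves the order,
    followed by the projection to the circle, which turns the linear order of
    (-1/2, 1/2) into a circular order ([mod1_sorted_rot]).  This gives the
    isomorphism of spiders.

    For the recursion, write x_n and x'_n for the values of sigma^n s in the
    bases d and d+1.  The orbit of theta_d stays near 0, so its base-d digits
    are at most B or at least d-B-1; the digit j = B+1 does not occur once
    d >= 2B+4.  Hence u_{j,theta} only leaves the small digits as they are and
    adds 1 to the large ones, and comparing with the digits of x_n gives
      u_{n+1} = s_{n+1} - [x_{n+1} < 0] + (d+1) [x_n < 0]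
    ([u_digit_mod1]).  The numbers v_n = x'_n + [x_n < 0] therefore satisfy
    (d+1) v_n = u_{n+1} + v_{n+1}, so the series defining Z_j(theta_d)
    telescopes to v_0, which is congruent to x'_0 modulo 1: this is
    theta_{d+1}. *)

(** * Eventually periodic orbits *)

Section EventuallyPeriodic.
Variables (T : Type) (f : T -> T) (x : T) (l k : nat).
Hypothesis hx : exact_preperiod_period f x l k.

Lemma period_gt0 : (0 < k)%N.
Proof. by case: hx => -[]. Qed.

Lemma iter_period n : (l <= n)%N -> iter (n + k) f x = iter n f x.
Proof.
case: hx => -[_ per _] _ le_ln.
by rewrite -(subnK le_ln) -addnA (addnC l) !iterD per.
Qed.

Lemma iter_reduce n : exists2 m, (m < l + k)%N & iter n f x = iter m f x.
Proof.
elim: n => [|n [m lt_m e]].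
  by exists 0%N => //; rewrite addn_gt0 period_gt0 orbT.
rewrite iterS e -iterS; have [lt_m'|ge_m'] := ltnP m.+1 (l + k).
  by exists m.+1.
exists l; first by rewrite -[ltnLHS]addn0 ltn_add2l period_gt0.
by rewrite -(iter_period (leqnn l)); congr (iter _ f x); lia.
Qed.

(** Together with [iter_reduce], this identifies the orbit with its first
    l + k points. *)
Lemma iter_preperiod_inj :
  {in [pred n | (n < l + k)%N] &, injective (fun n => iter n f x)}.
Proof.
have key n m : (n < m)%N -> (m < l + k)%N -> iter n f x <> iter m f x.
  case: hx => -[_ per minp] prep lt_nm lt_m.
  have [lt_nl|le_ln] := ltnP n l.
    move=> e; apply: (prep n lt_nl (m - n)%N); first by rewrite subn_gt0.
    by rewrite -iterD subnK // ltnW.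
  move=> e; apply: (minp (m - n)%N); first by apply/andP; split; lia.
  (* After i more steps, n reaches k + l: the coincidence becomes a period
     m - n < k of the l-th iterate. *)
  have [i [i_n hi]] :
      exists i, (i + n = k + l)%N /\ (i + m = (m - n) + (k + l))%N.
    by exists (k + l - n)%N; lia.
  by have := congr1 (iter i f) e; rewrite -!iterD i_n hi !iterD per => /esym.
move=> n m /[!inE] lt_n lt_m /= e.
case: (ltngtP n m) => // [lt|lt]; last symmetry in e.
- by case: (key _ _ lt lt_m e).
- by case: (key _ _ lt lt_n e).
Qed.
End EventuallyPeriodic.

(** * Addresses and reduction modulo 1 *)

Lemma iter_left_shiftE n (t : nat -> int) i :
  iter n left_shift t i = t (n + i)%N.
Proof. by elim: n i => //= n IH i; rewrite /left_shift IH addnS. Qed.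

Lemma lexlt_total (t t' : nat -> int) : t <> t' -> ~~ lexlt t t' -> lexlt t' t.
Proof.
move=> ne nlt; have ex : exists i, t i != t' i.
  apply: contrapT => h; apply: ne; apply/funext => i.
  by apply: contrapT => /eqP hi; apply: h; exists i.
case: (ex_minnP ex) => n ne_n min_n.
have eq_lt i : (i < n)%N -> t i = t' i.
  by move=> lt_in; apply/eqP; apply: contraTT lt_in => /min_n; rewrite -leqNgt.
have := ne_n; rewrite neq_lt => /orP[lt|lt].
- by case/negP: nlt; apply/asboolP; exists n.
- by apply/asboolP; exists n; split=> // i /eq_lt.
Qed.

Section Mod1.
Variable F : archiRealFieldType.
Implicit Types x : F.

Lemma mod1_itv x : 0 <= mod1 x < 1.
Proof. by have := floor_itv x; rewrite /mod1 intrD; lra. Qed.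

Lemma mod1Dz x (m : int) : mod1 (x + m%:~R) = mod1 x.
Proof. by rewrite /mod1 floorDrz ?intr_int// intrKfloor intrD; ring. Qed.

Lemma mod1_small x : `|x| < 1 / 2 -> mod1 x = x + (x < 0)%R%:R.
Proof.
rewrite ltr_norml => /andP[x_gt x_lt]; case: (ltP x 0) => x0 /=.
  rewrite -(mod1Dz _ 1) /mod1 (@floor_def _ _ 0) ?intrD//=; lra.
by rewrite /mod1 (@floor_def _ _ 0) ?intrD//=; lra.
Qed.

Lemma mod1_small_inj x y :
  `|x| < 1 / 2 -> `|y| < 1 / 2 -> mod1 x = mod1 y -> x = y.
Proof.
move=> x2 y2; rewrite !mod1_small //; move: x2 y2; rewrite !ltr_norml.
by case: (x < 0); case: (y < 0) => /=; lra.
Qed.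
End Mod1.

Lemma mod1_ratr (R : realType) (x : rat) : mod1 (ratr x) = ratr (mod1 x) :> R.
Proof. by rewrite /mod1 floor_rat rmorphB /= ratr_int. Qed.

(** * Signed base-d expansions of addresses *)

Section AddressValue.
Variables (d B : nat).
Hypothesis hd : (2 * B + 2 <= d)%N.
Variables (l k : nat).
Hypothesis hk : (0 < k)%N.

Definition truncated_value (m : nat) (t : nat -> int) : rat :=
  \sum_(i < m) (t i)%:~R / d%:R ^+ i.+1.

(** The rational closed form of sum_{i >= 0} t_i / d^(i+1) for an address
    whose l-th shift has period k: the second factor is the geometric series
    of ratio d^-k that sums the repetitions of the periodic block. *)
Definition address_value (t : nat -> int) : rat :=
  truncated_value l t +
  d%:R ^- l * (1 - d%:R ^- k)^-1 * truncated_value k (iter l left_shift t).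

Let d_gt1 : 1 < d%:R :> rat.
Proof. by rewrite ltr1n; lia. Qed.

Let d_neq0 : d%:R != 0 :> rat.
Proof. by rewrite gt_eqF // (lt_trans ltr01). Qed.

Let dk_gt0 : 0 < 1 - d%:R ^- k :> rat.
Proof.
by rewrite subr_gt0 invf_lt1 ?exprn_egt1 ?exprn_gt0 ?(lt_trans ltr01) -?lt0n.
Qed.

Lemma truncated_value_recl m t :
  truncated_value m.+1 t =
  ((t 0%N)%:~R + truncated_value m (left_shift t)) / d%:R.
Proof.
rewrite /truncated_value big_ord_recl /= expr1 mulrDl mulr_suml; congr (_ + _).
by apply: eq_bigr => i _; rewrite -mulrA -invfM -exprSr.
Qed.

Lemma truncated_value_recr m t :
  truncated_value m.+1 t = truncated_value m t + (t m)%:~R / d%:R ^+ m.+1.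
Proof. by rewrite /truncated_value big_ord_recr. Qed.

(** This recursion and the bound below are the only properties of
    [address_value] that matter: they characterize the sum of the series. *)
Lemma address_valueS t :
  iter (l + k) left_shift t = iter l left_shift t ->
  d%:R * address_value t = (t 0%N)%:~R + address_value (left_shift t).
Proof.
move=> per; rewrite /address_value -iterSr iterS.
set u := iter l left_shift t.
have uk : u k = u 0%N.
  by rewrite /u -[in RHS]per !iter_left_shiftE; congr t; lia.
have ul : u 0%N = t l by rewrite /u iter_left_shiftE addn0.
have := truncated_value_recl l t; rewrite truncated_value_recr -ul.
have := truncated_value_recl k u; rewrite truncated_value_recr uk.
have dk0 : d%:R ^+ k != 0 :> rat by rewrite expf_neq0.
have dl0 : d%:R ^+ l != 0 :> rat by rewrite expf_neq0.
rewrite !exprS => hQ hP.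
set P' := truncated_value l (left_shift t).
set Q' := truncated_value k (left_shift u).
have -> : Q' =
    d%:R * (truncated_value k u + (u 0%N)%:~R / (d%:R * d%:R ^+ k)) - (u 0%N)%:~R.
  by rewrite hQ -/Q'; field.
have -> : P' =
    d%:R * (truncated_value l t + (u 0%N)%:~R / (d%:R * d%:R ^+ l)) - (t 0%N)%:~R.
  by rewrite hP -/P'; field.
field; rewrite d_neq0 dk0 dl0 andbT subr_eq0 /=.
by rewrite gt_eqF // exprn_egt1 // -lt0n.
Qed.

(** The multiplier d - 1 keeps the geometric sums of B / d^(i+1) free of
    denominators, so that the bounds for the preperiodic and the periodic part
    add up exactly to B. *)
Lemma truncated_value_bound m t : (forall n, `|t n| <= B%:Z) ->
  d.-1%:R * `|truncated_value m t| <= B%:R * (1 - d%:R ^- m).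
Proof.
move=> tB; have d1 : d.-1%:R = d%:R - 1 :> rat.
  by rewrite -[in RHS](@prednK d) ?mulrSr ?addrK//; lia.
elim: m => [|m IH].
  by rewrite /truncated_value big_ord0 normr0 mulr0 expr0 invr1 subrr mulr0.
rewrite truncated_value_recr.
have dm : 0 < d%:R ^+ m.+1 :> rat by rewrite exprn_gt0 // (lt_trans ltr01).
have hB : `|(t m)%:~R| <= B%:R :> rat.
  by rewrite -intr_norm -[B%:R]/(B%:Z%:~R) ler_int.
apply: le_trans
  (_ : d.-1%:R * (`|truncated_value m t| + B%:R / d%:R ^+ m.+1) <= _).
  apply: ler_wpM2l; first by rewrite ler0n.
  rewrite (le_trans (ler_normD _ _)) // lerD2l normrM normfV (gtr0_norm dm).
  by rewrite ler_pM2r ?invr_gt0.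
rewrite mulrDr; apply: le_trans (lerD IH (lexx _)) _; rewrite d1 exprS.
have dm0 : d%:R ^+ m != 0 :> rat by rewrite expf_neq0.
rewrite le_eqVlt; apply/orP; left; apply/eqP; field.
by rewrite d_neq0 dm0.
Qed.

Lemma address_value_bound t : (forall n, `|t n| <= B%:Z) ->
  d.-1%:R * `|address_value t| <= B%:R.
Proof.
move=> tB; have tB' n : `|iter l left_shift t n| <= B%:Z.
  by rewrite iter_left_shiftE.
have h1 := truncated_value_bound l tB; have h2 := truncated_value_bound k tB'.
have dl : 0 < d%:R ^- l :> rat.
  by rewrite invr_gt0 exprn_gt0 // (lt_trans ltr01).
have c0 : 0 < d%:R ^- l * (1 - d%:R ^- k)^-1 :> rat.
  by apply: mulr_gt0 => //; rewrite invr_gt0.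
apply: le_trans (ler_wpM2l (ler0n _ _) (ler_normD _ _)) _.
rewrite [`|_ * truncated_value k _|]normrM (gtr0_norm c0) mulrDr.
rewrite [_ * (_ * `|_|)]mulrCA.
apply: le_trans (lerD h1 (ler_wpM2l (ltW c0) h2)) _.
rewrite le_eqVlt; apply/orP; left; apply/eqP.
by rewrite mulrCA -[X in _ + _ * X]mulrA mulVf ?gt_eqF//; ring.
Qed.

Lemma address_value_small t : (forall n, `|t n| <= B%:Z) ->
  `|address_value t| < 1 / 2.
Proof.
move=> tB; have := address_value_bound tB.
have : (2 * B + 1)%:R <= d.-1%:R :> rat by rewrite ler_nat; lia.
rewrite natrD natrM; have := ler0n rat B.
move: (B%:R : rat) (d.-1%:R : rat) (address_value t) => b e x b0 be.
rewrite ltNge; apply: contraTN => x_ge; rewrite -ltNge.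
by nra.
Qed.

(** Equal leading entries cancel in the recursion; at the first distinct one,
    the entries differ by at least 1 and the tails by less than 1. *)
Lemma address_value_mono t t' :
  (forall n, `|t n| <= B%:Z) -> (forall n, `|t' n| <= B%:Z) ->
  iter (l + k) left_shift t = iter l left_shift t ->
  iter (l + k) left_shift t' = iter l left_shift t' ->
  lexlt t t' -> address_value t < address_value t'.
Proof.
move=> tB t'B per per' /asboolP[n [eq_n lt_n]].
have d0 : 0 < d%:R :> rat by rewrite (lt_trans ltr01).
have perS v : iter (l + k) left_shift v = iter l left_shift v ->
  iter (l + k) left_shift (left_shift v) = iter l left_shift (left_shift v).
  by move=> pv; rewrite -!iterSr !iterS pv.
elim: n => [|n IH] in t t' tB t'B per per' eq_n lt_n *;
    rewrite -(ltr_pM2l d0) (address_valueS per) (address_valueS per').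
  have := address_value_small (fun n => tB n.+1).
  have := address_value_small (fun n => t'B n.+1).
  rewrite !ltr_norml => /andP[? ?] /andP[? ?].
  have : (t 0%N + 1)%:~R <= (t' 0%N)%:~R :> rat by rewrite ler_int; lia.
  by rewrite intrD /left_shift; lra.
rewrite (eq_n 0%N) // ltrD2l.
exact: IH (fun m => tB m.+1) (fun m => t'B m.+1) (perS _ per) (perS _ per')
  (fun m => eq_n m.+1) lt_n.
Qed.

Section Reflection.
Variables t t' : nat -> int.
Hypothesis tB : forall n, `|t n| <= B%:Z.
Hypothesis t'B : forall n, `|t' n| <= B%:Z.
Hypothesis per : iter (l + k) left_shift t = iter l left_shift t.
Hypothesis per' : iter (l + k) left_shift t' = iter l left_shift t'.

Lemma address_value_lexlt :
  address_value t < address_value t' -> lexlt t t'.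
Proof.
move=> lt_x; apply: contraTT (lt_x) => nlt; rewrite -leNgt.
have [->//|ne] := pselect (t = t').
exact/ltW/(address_value_mono t'B tB per' per)/lexlt_total.
Qed.

Lemma address_value_inj : address_value t = address_value t' -> t = t'.
Proof.
move=> e; apply: contrapT => ne.
have [lt|nlt] := boolP (lexlt t t').
  by have := address_value_mono tB t'B per per' lt; rewrite e ltxx.
have := address_value_mono t'B tB per' per (lexlt_total ne nlt).
by rewrite e ltxx.
Qed.
End Reflection.
End AddressValue.

(** * The digits u and the map Z *)

Section Digits.
Variable R : realType.

(** A bounded solution v of e v_n = u_n + v_{n+1} is the tail sum of the
    expansion with digits u: the partial sums are v_0 - v_n / e^n. *)
Lemma limn_series_expansion (e C : R) (u v : nat -> R) :
  1 < e -> (forall n, `|v n| <= C) -> (forall n, e * v n = u n + v n.+1) ->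
  limn (series (fun n => u n / e ^+ n.+1)) = v 0%N.
Proof.
move=> e1 vC rec; have e0 : e != 0 by rewrite gt_eqF // (lt_trans ltr01).
have -> : series (fun n => u n / e ^+ n.+1) = (fun n => v 0%N - v n * e ^- n).
  apply/funext => n; rewrite /series /=; elim: n => [|n IH].
    by rewrite big_geq // expr0 invr1 mulr1 subrr.
  rewrite big_nat_recr //= IH.
  have -> : u n = e * v n - v n.+1 by rewrite rec addrK.
  by rewrite exprS; field; rewrite e0 expf_neq0.
apply/cvg_lim; first exact: Rhausdorff.
rewrite -[X in (_ --> X)%classic]subr0; apply: cvgB; first exact: cvg_cst.
have hg : (geometric C e^-1 n @[n --> \oo] --> (0 : R))%classic.
  apply: cvg_geometric; rewrite normfV.
  by rewrite gtr0_norm ?invf_lt1 // (lt_trans ltr01).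
apply: (@squeeze_cvgr _ _ _ _ (fun n => - geometric C e^-1 n)
  (geometric C e^-1)) => //; last by rewrite -oppr0; apply: cvgN.
near=> n; rewrite -ler_norml normrM /geometric /= exprVn.
have en : 0 < e ^- n by rewrite invr_gt0 exprn_gt0 // (lt_trans ltr01).
by rewrite (gtr0_norm en) ler_pM2r.
Unshelve. all: by end_near. Qed.

Lemma truncn_floor_ge0 (F : archiRealFieldType) (y : F) :
  0 <= y -> (Num.truncn y)%:Z = Num.floor y.
Proof. by move=> y0; rewrite truncn_floor y0 gez0_abs // floor_ge0. Qed.

(** The critical angle (theta + j) / d has leading digit j, so an angle with
    another leading digit lies in one of the sectors below or above it. *)
Lemma u_digit_skip d j theta t : (0 < d)%N -> is_angle theta ->
  Num.truncn (d%:R * t) <> j ->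
  u_digit R d j theta t =
  if (Num.truncn (d%:R * t) < j)%N then Num.truncn (d%:R * t)
  else (Num.truncn (d%:R * t)).+1.
Proof.
move=> d0 /andP[th0 th1] /eqP ne; rewrite /u_digit.
have -> : (t == (theta + j%:R) / d%:R) = false.
  apply: contraNF ne => /eqP ->; rewrite mulrCA mulfV ?pnatr_eq0 -?lt0n// mulr1.
  by apply/eqP/truncn_def; rewrite -natr1; lra.
by case: ltngtP ne.
Qed.

(** The pair (x, y) stands for two successive points of the orbit, represented
    in (-1/2, 1/2), and a for the entry of the address between them.  Since
    d x = a + y, reducing y to [0, 1) borrows 1 from a when y < 0, and reducing
    x adds d when x < 0, which the skipped digit B+1 turns into d + 1. *)
Lemma u_digit_mod1 (d B : nat) (a : int) (theta x y : rat) :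
  (2 * B + 4 <= d)%N -> is_angle theta ->
  d%:R * x = a%:~R + y -> d.-1%:R * `|x| <= B%:R ->
  `|x| < 1 / 2 -> `|y| < 1 / 2 ->
  (u_digit R d B.+1 theta (mod1 x))%:R =
    a%:~R - (y < 0)%R%:R + d.+1%:R * (x < 0)%R%:R :> R.
Proof.
move=> hd th rec xB x2 y2; set t := mod1 x.
have tE : t = x + (x < 0)%R%:R by exact: mod1_small.
have d1 : d.-1%:R = d%:R - 1 :> rat.
  by rewrite -[in RHS](@prednK d) ?mulrSr ?addrK//; lia.
have hdB : (2 * B + 4)%:R <= d%:R :> rat by rewrite ler_nat.
have [t0 t1] := andP (mod1_itv x).
have dt0 : 0 <= d%:R * t by rewrite mulr_ge0.
have floorE : Num.floor (d%:R * t) = a - (y < 0)%R%:R + d%:Z * (x < 0)%R%:R.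
  apply: floor_def; rewrite tE mulrDr rec !(intrD, intrM, rmorphN) /=.
  move: y2; rewrite ltr_norml => /andP[? ?].
  by case: (ltP y 0) => ? /=; case: (x < 0) => /=; rewrite ?mulr1 ?mulr0; lra.
have := truncn_floor_ge0 dt0; rewrite floorE => mE.
have sep : if (x < 0) then (B.+1 < Num.truncn (d%:R * t))%N
           else (Num.truncn (d%:R * t) < B.+1)%N.
  have := tE; move: xB x2 hdB; rewrite d1 natrD natrM.
  case: (ltP x 0) => x0.
    rewrite (ltr0_norm x0) => xB' x2' hdB tE'.
    by rewrite truncn_ge_nat // tE' -!natr1 mulrDr mulr1; lra.
  rewrite (ger0_norm x0) => xB' x2' hdB tE'.
  by rewrite truncn_lt_nat // tE' -natr1 mulrDr mulr0 addr0; lra.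
have mER : (Num.truncn (d%:R * t))%:R =
    a%:~R - (y < 0)%R%:R + d%:R * (x < 0)%R%:R :> R.
  rewrite -[LHS]/((Num.truncn (d%:R * t))%:Z%:~R) mE !(intrD, intrM) mulrNz.
  by case: (y < 0); case: (x < 0).
rewrite u_digit_skip //; [|lia|]; last first.
  by case: ifP sep => _ /[swap] ->; rewrite ltnn.
case: ifP sep => x0 sep.
  by rewrite ltnNge (ltnW sep) /= -natr1 mER x0 mulr1 -[d.+1%:R]natr1; ring.
by rewrite sep mER x0 !mulr0.
Qed.
End Digits.

(** * Circular order of the legs *)

(** On [0, 1), the reductions of the nonnegative points of (-1/2, 1/2) precede
    those of the negative ones; rotating at the first negative point restores
    the linear order. *)
Lemma mod1_sorted_rot (T : eqType) (x : T -> rat) (ns : seq T) :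
  (forall n, `|x n| < 1 / 2) ->
  sorted (fun a b : rat => a < b) [seq mod1 (x n) | n <- ns] ->
  exists r, sorted (fun a b : rat => a < b) [seq x n | n <- rot r ns].
Proof.
move=> x2; rewrite lt_sorted_pairwise => srt.
pose neg n := x n < 0; pose r := find neg ns; exists r.
have mE n : mod1 (x n) = x n + (neg n)%:R by exact: mod1_small.
have pos_take : all (predC neg) (take r ns).
  by rewrite all_predC has_take_leq ?find_size// ltnn.
have lt_mod n m : mod1 (x n) < mod1 (x m) -> neg n -> neg m.
  move: (x2 n) (x2 m); rewrite !mE /neg !ltr_norml.
  by case: (ltP (x n) 0); case: (ltP (x m) 0) => //=; lra.
have lt_same n m : neg n = neg m -> mod1 (x n) < mod1 (x m) -> x n < x m.
  by rewrite !mE => ->; rewrite ltrD2r.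
rewrite lt_sorted_pairwise.
move: srt; rewrite -{1}(cat_take_drop r ns) /rot !map_cat !pairwise_cat.
move=> /and3P[_ srt_t srt_d].
have neg_drop : all neg (drop r ns).
  have [lt_r|] := ltnP r (size ns); last by move/drop_oversize => ->.
  case: ns => [//|n0 ns'] in r lt_r pos_take srt_t srt_d *.
  move: srt_d; rewrite (drop_nth n0) //= => /andP[lt_all _].
  have neg_r : neg (nth n0 (n0 :: ns') r) by rewrite nth_find // has_find.
  rewrite neg_r /=; apply/allP => m m_in; apply: lt_mod neg_r.
  by move/allP: lt_all; apply; apply: map_f.
apply/and3P; split.
- apply/allrelP => _ _ /mapP[n n_in ->] /mapP[m m_in ->].
  apply: (lt_le_trans (allP neg_drop _ n_in)).
  by rewrite leNgt; apply: (allP pos_take).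
- move: srt_d; rewrite !pairwise_map; apply: sub_in_pairwise neg_drop.
  by move=> n m n_neg m_neg /=; apply: lt_same;
    rewrite (n_neg : neg n) (m_neg : neg m).
- move: srt_t; rewrite !pairwise_map; apply: sub_in_pairwise pos_take.
  move=> n m n_pos m_pos /=; apply: lt_same.
  by rewrite (negPf (n_pos : ~~ neg n)) (negPf (m_pos : ~~ neg m)).
Qed.

Theorem lemma1p3 (R : realType) (s : nat -> int) (l k : nat)
    (hl : (1 <= l)%N) (hk : (1 <= k)%N)
    (hs : exact_preperiod_period left_shift s l k) (hs1 : s 0%N = 0) :
  exists (D j : nat) (theta : nat -> rat),
    [/\ (2 <= D)%N, (j < D)%N,
        forall d : nat, (D <= d)%N -> is_angle (theta d),
        forall d : nat, (D <= d)%N ->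
          ratr (theta d.+1) = Zmap R d j (theta d) &
        forall d : nat, (D <= d)%N ->
          spiders_isomorphic d (theta d) s l k].
Proof.
pose sh n := iter n left_shift s.
pose B := \max_(i < l + k) `|s i|%N.
have shB n i : `|sh n i| <= B%:Z.
  rewrite /sh iter_left_shiftE; have [m lt_m e] := iter_reduce hs (n + i).
  have -> : s (n + i)%N = s m.
    by have := congr1 (fun t => t 0%N) e; rewrite /= !iter_left_shiftE !addn0.
  rewrite -abszE lez_nat.
  exact: (@leq_bigmax _ (fun i : 'I_(l + k) => `|s i|%N) (Ordinal lt_m)).
have per n : iter (l + k) left_shift (sh n) = iter l left_shift (sh n).
  by rewrite /sh -!iterD addnAC (iter_period hs) // leq_addr.
pose x d n := address_value d l k (sh n).
have xS d n : (2 * B + 2 <= d)%N -> d%:R * x d n = (s n)%:~R + x d n.+1.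
  move=> hd; rewrite /x (address_valueS hd hk (per n)).
  by rewrite /sh iter_left_shiftE addn0.
have x_small d n : (2 * B + 2 <= d)%N -> `|x d n| < 1 / 2.
  by move=> hd; apply: (address_value_small hd).
have orbitE d n : (2 * B + 2 <= d)%N ->
    angle_iter d (mod1 (x d 0%N)) n = mod1 (x d n).
  move=> hd; rewrite /angle_iter; elim: n => //= n ->; rewrite /mul_angle.
  rewrite [X in mod1 (_ * X)]/mod1 mulrBr xS //.
  rewrite -[X in _ - X * _]/(d%:Z%:~R) -intrM -mulrNz.
  by rewrite mod1Dz addrC mod1Dz.
(* The digits that occur are at most B or at least d - B - 1 >= B + 3, on
   either side of j = B + 1. *)
exists (2 * B + 4)%N, B.+1, (fun d => mod1 (x d 0%N)).
split; [lia|lia|by move=> d _; apply: mod1_itv| |]; move=> d hd.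
  have hd2 : (2 * B + 2 <= d)%N by lia.
  have hdS : (2 * B + 2 <= d.+1)%N by lia.
  (* The second term adjusts to the signs in base d, from which u is read. *)
  pose v n : R := ratr (x d.+1 n) + (x d n < 0)%R%:R.
  rewrite /Zmap (@limn_series_expansion _ d.+1%:R 2 _ v).
  - rewrite /v -mod1_ratr -[X in _ = mod1 (_ + X)]/((x d 0%N < 0)%R%:Z%:~R).
    by rewrite mod1Dz.
  - by rewrite ltr1n; lia.
  - move=> n; rewrite /v; have := x_small d.+1 n hdS.
    rewrite ltr_norml -(ltr_rat R (- _)) -(ltr_rat R _ (1 / 2)).
    rewrite (rmorphN (ratr : rat -> R)).
    have -> : ratr (1 / 2) = 1 / 2 :> R.
      by rewrite fmorph_div rmorph1 rmorph_nat.
    rewrite ler_norml => /andP[? ?].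
    by case: (x d n < 0) => /=; lra.
  move=> n; rewrite orbitE // (u_digit_mod1 R hd _ (xS d n hd2)) //.
  - rewrite /v mulrDr -[X in X * ratr _]ratr_nat.
    rewrite -rmorphM /= xS // rmorphD /= ratr_int.
    by ring.
  - exact: mod1_itv.
  - exact: address_value_bound.
  - exact: x_small.
  - exact: x_small.
have hd2 : (2 * B + 2 <= d)%N by lia.
split.
  have -> : angle_orbit d (mod1 (x d 0%N)) =
      [set mod1 (x d n) | n in `I_(l + k)]%classic.
    rewrite /angle_orbit; apply/seteqP; split=> [_ [n _ <-]|_ [n _ <-]].
      have [m lt_m e] := iter_reduce hs n; exists m => //.
      by rewrite orbitE // /x /sh e.
    by exists n => //; rewrite orbitE.
  apply: inj_card_eq => n m; rewrite !inE /= => lt_n lt_m e.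
  have {e} := mod1_small_inj (x_small d n hd2) (x_small d m hd2) e.
  move=> /(address_value_inj hd2 hk (shB n) (shB m) (per n) (per m)).
  exact: (iter_preperiod_inj hs).
move=> ns _ [r]; rewrite -map_rot.
under eq_map do rewrite orbitE //.
move=> /(mod1_sorted_rot (fun n => x_small d n hd2))[r'].
rewrite rot_rot_add => srt; exists (rot_add ns r r').
move: srt; rewrite !sorted_map; apply: sub_sorted => n m /=.
exact: (address_value_lexlt hd2 hk).
Qed.
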